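(* The following are equivalent for any ordered magma $M$. (1) $M$ is a precoherent near prequantale. (2) $M$ is isomorphic (as an ordered magma) to the ideal completion $\mathrm{Idl}(N)$ under $\downarrow$-multiplication of some multiplicative semilattice $N$. (3) $\mathsf{K}(M)$ is a sub multiplicative semilattice of $M$ and $M$ is isomorphic to the ordered magma $\mathrm{Idl}(\mathsf{K}(M))$ under $\downarrow$-multiplication. (4) $M$ is isomorphic to $(2^N\setminus\{\emptyset\})^\star$ for some multiplicative semilattice $N$ and some finitary nucleus $\star$ on $2^N\setminus\{\emptyset\}$.
   Context: An ordered magma is a set with a binary operation (written multiplicatively, not assumed associative, commutative or unital) and a partial order such that $x\le x'$ and $y\le y'$ imply $xy\le x'y'$. A near prequantale is an ordered magma $Q$ such that for every nonempty subset $X$ of $Q$, $\bigvee X$ exists and $a(\bigvee X)=\bigvee(aX)$, $(\bigvee X)a=\bigvee(Xa)$ for all $a\in Q$. A multiplicative semilattice is an ordered magma $N$ in which any two elements have a supremum and $a(x\vee y)=ax\vee ay$, $(x\vee y)a=xa\vee ya$ for all $a,x,y\in N$. ''$\mathsf{K}(M)$ is a sub multiplicative semilattice of $M$'' means that $\mathsf{K}(M)$ is closed under multiplication, that any two elements of $\mathsf{K}(M)$ have a supremum in $M$ and it lies in $\mathsf{K}(M)$, and that $\mathsf{K}(M)$ is a multiplicative semilattice with the induced structure. A directed subset of a poset is a nonempty subset $\Delta$ such that every finite subset of $\Delta$ has an upper bound in $\Delta$. An element $x$ of a poset $S$ is compact if whenever $x\le\bigvee\Delta$ for a directed $\Delta\subset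 S$ whose supremum exists, one has $x\le y$ for some $y\in\Delta$; $\mathsf{K}(S)$ is the set of compact elements of $S$. An ordered magma is precoherent if every element is a supremum of a set of compact elements and its set of compact elements is closed under multiplication. An ideal of a poset is a directed downward closed subset; $\mathrm{Idl}(S)$ is the set of ideals of $S$ ordered by inclusion. For a nonempty subset $X$ of a join semilattice $S$, $\downarrow\! X=\{y\in S: y\le\bigvee T\text{ for some finite nonempty }T\subset X\}$. $\downarrow$-multiplication on $\mathrm{Idl}(N)$ is $(I,J)\mapsto\,\downarrow\!(IJ)$, where $IJ=\{xy:x\in I,y\in J\}$. $2^N\setminus\{\emptyset\}$ is the set of nonempty subsets of $N$, ordered by inclusion, with multiplication $XY=\{xy:x\in X,y\in Y\}$. A closure operation is an expansive, order-preserving, idempotent self-map $\star$ ($x^\star=\star(x)$); a nucleus on an ordered magma is a closure operation with $x^\star y^\star\le(xy)^\star$ for all $x,y$; it is finitary if $(\bigvee\Delta)^\star=\bigvee\{x^\star:x\in\Delta\}$ for every directed $\Delta$ whose supremum exists. For a nucleus $\star$ on $P$, $P^\star$ is the image of $\star$ with the induced order and multiplication $(x,y)\mapsto(xy)^\star$. *)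

(* Defs.v *)
From HB Require Import structures.
From mathcomp Require Import all_boot all_order.
From mathcomp Require Import boolp classical_sets functions cardinality.

Set Implicit Arguments.
Unset Strict Implicit.
Unset Printing Implicit Defensive.

Import Order.TTheory.

Local Open Scope classical_set_scope.
Local Open Scope group_scope.
Local Open Scope order_scope.

HB.mixin Record isOrderedMagma d M of Order.POrder d M & Magma M := {
  lemul : forall x x' y y' : M, x <= x' -> y <= y' -> x * y <= x' * y'
}.

#[short(type="orderedMagmaType")]
HB.structure Definition OrderedMagma d :=
  {M of isOrderedMagma d M & Order.POrder d M & ChoiceMagma M}.

HB.mixin Record isMultSemilattice d N
    of Order.JoinSemilattice d N & Magma N := {
  mulUr : forall a x y : N, a * Order.join x y = Order.join (a * x) (a * y);
  mulUl : forall a x y : N, Order.join x y * a = Order.join (x * a) (y * a)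
}.

#[short(type="multSemilatticeType")]
HB.structure Definition MultSemilattice d :=
  {N of isMultSemilattice d N & OrderedMagma d N & Order.JoinSemilattice d N}.

Definition isomorphic d d' (M : orderedMagmaType d) (M' : orderedMagmaType d') :
    Prop :=
  exists f : M -> M', [/\ bijective f, {mono f : x y / x <= y}
    & {morph f : x y / x * y}].

Section Posets.
Context d (S : porderType d).
Implicit Types (D X I : set S) (x : S).

Definition directed D : Prop :=
  D !=set0 /\ forall F, finite_set F -> F `<=` D -> exists2 u, D u & ubound F u.

Definition compact_element x : Prop :=
  forall D s, directed D -> isLub D s -> x <= s -> exists2 y, D y & x <= y.

Definition compacts : set S := [set x | compact_element x].

Definition is_ideal I : Prop :=
  directed I /\ forall x y, I x -> y <= x -> I y.

Lemma directedP D :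
  directed D <-> D !=set0 /\
    forall x y, D x -> D y -> exists u, [/\ D u, x <= u & y <= u].
Proof.
split=> -[D0 Ddir]; split=> //.
- move=> x y Dx Dy; have [||u Du uF] := Ddir [set x; y].
  + by rewrite finite_setU; split; exact: finite_set1.
  + by move=> z [] ->.
  + by exists u; split=> //; apply: uF; [left|right].
- move=> F /finite_seqP[s ->] sD.
  elim: s sD => [|x s IHs] sD.
    by have [x Dx] := D0; exists x => // y; rewrite /= in_nil.
  have [|u Du us] := IHs.
    by move=> y /= ys; apply: sD; rewrite /= inE ys orbT.
  have Dx : D x by apply: sD; rewrite /= mem_head.
  have [v [Dv xv uv]] := Ddir _ _ Dx Du.
  exists v => // y; rewrite /= inE => /orP[/eqP->//|ys].
  by apply: le_trans uv; apply: us.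
Qed.

End Posets.

Definition near_prequantale d (Q : orderedMagmaType d) : Prop :=
  forall X : set Q, X !=set0 -> exists2 s, isLub X s &
    forall a, isLub [set a * x | x in X] (a * s) /\
              isLub [set x * a | x in X] (s * a).

Definition precoherent d (Q : orderedMagmaType d) : Prop :=
  (forall x : Q, exists2 X : set Q, X `<=` @compacts d Q & isLub X x) /\
  (forall x y : Q, compact_element x -> compact_element y ->
     compact_element (x * y)).

(* A binary join of elements of A is taken in M. The order and the
   multiplication of A being those of M, compatibility with the order is
   automatic, so that the last two clauses say that A is a multiplicative
   semilattice with the induced structure. *)
Record sub_mult_semilattice d (M : orderedMagmaType d) (A : set M) : Prop := {
  sub_mul : forall x y, A x -> A y -> A (x * y);
  sub_lub : forall x y, A x -> A y -> exists2 s, A s & isLub [set x; y] s;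
  sub_mulUr : forall a x y s, A a -> A x -> A y ->
    isLub [set x; y] s -> isLub [set a * x; a * y] (a * s);
  sub_mulUl : forall a x y s, A a -> A x -> A y ->
    isLub [set x; y] s -> isLub [set x * a; y * a] (s * a)
}.

Definition sub_msl d (M : orderedMagmaType d) (A : set M)
  (h : sub_mult_semilattice A) : Type := {x : M | x \in A}.

Section SubMultSemilattice.
Context d (M : orderedMagmaType d) (A : set M) (h : sub_mult_semilattice A).

HB.instance Definition _ := SubChoice.copy (sub_msl h) {x : M | x \in A}.
HB.instance Definition _ := [SubChoice_isSubPOrder of sub_msl h by <: with d].

Implicit Types x y z : sub_msl h.

Lemma sub_mslP x : A (val x).
Proof. by have := valP x; rewrite inE. Qed.

Definition sub_Sub (x : M) (Ax : A x) : sub_msl h := exist _ x (mem_set Ax).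

Definition sub_msl_mul x y : sub_msl h :=
  sub_Sub (sub_mul h (sub_mslP x) (sub_mslP y)).

HB.instance Definition _ := hasMul.Build (sub_msl h) sub_msl_mul.

Lemma sub_msl_lemul x x' y y' : x <= x' -> y <= y' -> x * y <= x' * y'.
Proof. by rewrite -!Order.le_val; exact: lemul. Qed.

HB.instance Definition _ := isOrderedMagma.Build d (sub_msl h) sub_msl_lemul.

Definition sub_msl_join x y : sub_msl h :=
  let s := cid2 (sub_lub h (sub_mslP x) (sub_mslP y)) in sub_Sub (s2valP s).

Lemma sub_msl_joinP x y : isLub [set val x; val y] (val (sub_msl_join x y)).
Proof. exact: (s2valP' (cid2 (sub_lub h (sub_mslP x) (sub_mslP y)))). Qed.

Lemma sub_msl_leUx x y z : (sub_msl_join x y <= z) = (x <= z) && (y <= z).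
Proof.
have [ub lub] := sub_msl_joinP x y; rewrite -!Order.le_val.
apply/idP/andP => [xyz|[xz yz]].
  by split; apply: le_trans xyz; apply: ub; [left|right].
by apply: lub => _ [] ->.
Qed.

HB.instance Definition _ :=
  Order.POrder_isJoinSemilattice.Build d (sub_msl h) sub_msl_leUx.

Lemma isLub_uniq (X : set M) s t : isLub X s -> isLub X t -> s = t.
Proof. by move=> [uX sX] [vX tX]; apply/le_anti; rewrite sX // tX. Qed.

Lemma sub_msl_mulUr a x y : a * Order.join x y = Order.join (a * x) (a * y).
Proof.
apply: val_inj; apply: isLub_uniq (sub_msl_joinP (a * x) (a * y)).
by apply: (sub_mulUr h) (sub_msl_joinP x y) => //; exact: sub_mslP.
Qed.

Lemma sub_msl_mulUl a x y : Order.join x y * a = Order.join (x * a) (y * a).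
Proof.
apply: val_inj; apply: isLub_uniq (sub_msl_joinP (x * a) (y * a)).
by apply: (sub_mulUl h) (sub_msl_joinP x y) => //; exact: sub_mslP.
Qed.

HB.instance Definition _ :=
  isMultSemilattice.Build d (sub_msl h) sub_msl_mulUr sub_msl_mulUl.

End SubMultSemilattice.

(* In a join semilattice the least upper bound s of T always exists. *)
Definition down_join d (S : joinSemilatticeType d) (X : set S) : set S :=
  [set y | exists T s,
     [/\ finite_set T, T !=set0, T `<=` X, isLub T s & y <= s]].

Definition mul_set d (N : orderedMagmaType d) (X Y : set N) : set N :=
  [set x * y | x in X & y in Y].

Section Down.
Context d (S : joinSemilatticeType d).
Implicit Types X Y : set S.

Lemma sub_down_join X : X `<=` down_join X.
Proof.
move=> x Xx; exists [set x], x; split=> //.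
- by exists x.
- by move=> _ ->.
- by split=> [_ ->//|b]; apply.
Qed.

Lemma down_join_mono X Y : X `<=` Y -> down_join X `<=` down_join Y.
Proof.
move=> XY y [T [s [fT T0 TX Ts ys]]]; exists T, s; split=> //.
exact: subset_trans TX XY.
Qed.

Lemma down_join_ideal X : X !=set0 -> is_ideal (down_join X).
Proof.
move=> [x0 Xx0]; split; last first.
  move=> x y [T [s [fT T0 TX Ts xs]]] yx.
  by exists T, s; split=> //; exact: le_trans yx xs.
apply/directedP; split; first by exists x0; exact: sub_down_join.
move=> x y [T [s [fT [t Tt] TX [Ts sT] xs]]] [U [r [fU _ UX [Ur rU] yr]]].
exists (Order.join s r); split.
- exists (T `|` U), (Order.join s r); split=> //.
  + by rewrite finite_setU.
  + by exists t; left.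
  + by move=> z [/TX|/UX].
  + split=> [z [/Ts|/Ur] zs|b bTU].
    * exact: le_trans zs (leUl _ _).
    * exact: le_trans zs (leUr _ _).
    * by rewrite leUx sT ?rU // => z zTU; apply: bTU; [right|left].
- exact: le_trans xs (leUl _ _).
- exact: le_trans yr (leUr _ _).
Qed.

End Down.

(* The order is inherited from set S, that is, inclusion. *)
Definition idl d (S : porderType d) : Type :=
  {I : set S | I \in [set J | is_ideal J]}.

HB.instance Definition _ d (S : porderType d) :=
  SubChoice.copy (idl S) {I : set S | I \in [set J | is_ideal J]}.
HB.instance Definition _ d (S : porderType d) :=
  [SubChoice_isSubPOrder of idl S by <: with set_display].

Section IdealCompletion.
Context d (N : multSemilatticeType d).
Implicit Types I J : idl N.

Lemma idlP I : is_ideal (val I).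
Proof. by have := valP I; rewrite inE. Qed.

Lemma down_mul_ideal I J : is_ideal (down_join (mul_set (val I) (val J))).
Proof.
have [[[x Ix] _] _] := idlP I; have [[[y Jy] _] _] := idlP J.
by apply: down_join_ideal; exists (x * y); exists x => //; exists y.
Qed.

Definition idl_mul I J : idl N :=
  Sub (down_join (mul_set (val I) (val J))) (mem_set (down_mul_ideal I J)).

HB.instance Definition _ := hasMul.Build (idl N) idl_mul.

Lemma idl_lemul I I' J J' : I <= I' -> J <= J' -> I * J <= I' * J'.
Proof.
rewrite -!Order.le_val !subsetEset => II' JJ'; apply: down_join_mono.
by move=> _ [x Ix [y Jy <-]]; exists x; [exact: II'|exists y; [exact: JJ'|]].
Qed.

HB.instance Definition _ := isOrderedMagma.Build set_display (idl N) idl_lemul.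

End IdealCompletion.

(* The order is inherited from set T, that is, inclusion. *)
Definition nonempty_sets (T : Type) : Type :=
  {X : set T | X \in [set Y | Y !=set0]}.

HB.instance Definition _ (T : Type) :=
  SubChoice.copy (nonempty_sets T) {X : set T | X \in [set Y | Y !=set0]}.
HB.instance Definition _ (T : Type) :=
  [SubChoice_isSubPOrder of nonempty_sets T by <: with set_display].

Section NonemptySets.
Context d (N : orderedMagmaType d).
Implicit Types X Y : nonempty_sets N.

Lemma nonempty_setsP X : val X !=set0.
Proof. by have := valP X; rewrite inE. Qed.

Lemma mul_set_nonempty X Y : mul_set (val X) (val Y) !=set0.
Proof.
have [x Xx] := nonempty_setsP X; have [y Yy] := nonempty_setsP Y.
by exists (x * y); exists x => //; exists y.
Qed.

Definition nonempty_sets_mul X Y : nonempty_sets N :=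
  Sub (mul_set (val X) (val Y)) (mem_set (mul_set_nonempty X Y)).

HB.instance Definition _ := hasMul.Build (nonempty_sets N) nonempty_sets_mul.

Lemma nonempty_sets_lemul X X' Y Y' : X <= X' -> Y <= Y' -> X * Y <= X' * Y'.
Proof.
rewrite -!Order.le_val !subsetEset => XX' YY'.
by move=> _ [x Xx [y Yy <-]]; exists x; [exact: XX'|exists y; [exact: YY'|]].
Qed.

HB.instance Definition _ :=
  isOrderedMagma.Build set_display (nonempty_sets N) nonempty_sets_lemul.

End NonemptySets.

Record closure_operation d (S : porderType d) (star : S -> S) : Prop := {
  closure_expansive : forall x, x <= star x;
  closure_homo : {homo star : x y / x <= y};
  closure_idem : forall x, star (star x) = star x
}.

Record nucleus d (P : orderedMagmaType d) (star : P -> P) : Prop := {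
  nucleus_closure : closure_operation star;
  nucleus_mul : forall x y, star x * star y <= star (x * y)
}.

Definition finitary d (S : porderType d) (star : S -> S) : Prop :=
  forall D s, directed D -> isLub D s -> isLub (star @` D) (star s).

Definition nucleus_image d (P : orderedMagmaType d) (star : P -> P)
  (h : nucleus star) : Type := {x : P | x \in range star}.

Section NucleusImage.
Context d (P : orderedMagmaType d) (star : P -> P) (h : nucleus star).

HB.instance Definition _ :=
  SubChoice.copy (nucleus_image h) {x : P | x \in range star}.
HB.instance Definition _ :=
  [SubChoice_isSubPOrder of nucleus_image h by <: with d].

Implicit Types x y : nucleus_image h.

Definition nucleus_image_mul x y : nucleus_image h :=
  Sub (star (val x * val y)) (mem_set (imageT star (val x * val y))).

HB.instance Definition _ := hasMul.Build (nucleus_image h) nucleus_image_mul.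

Lemma nucleus_image_lemul x x' y y' : x <= x' -> y <= y' -> x * y <= x' * y'.
Proof.
rewrite -!Order.le_val => xx' yy'; apply: (closure_homo (nucleus_closure h)).
exact: lemul.
Qed.

HB.instance Definition _ :=
  isOrderedMagma.Build d (nucleus_image h) nucleus_image_lemul.

End NucleusImage.

(* Main.v *)
(* The compact elements below a given element of a precoherent near prequantale
   form an ideal of K(M) whose supremum is that element, which identifies M with
   Idl(K(M)).  For a multiplicative semilattice N, X |-> down_join X is a finitary
   nucleus on the nonempty subsets of N, and its fixed points are the ideals of N.
   Finally, the nonempty subsets of N form a precoherent near prequantale, with
   finite sets as compact elements, and both properties pass to the image of a
   finitary nucleus. *)
Require Import Defs.
From mathcomp Require Import all_boot all_order.
From mathcomp Require Import boolp classical_sets cardinality.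

Set Implicit Arguments.
Unset Strict Implicit.
Unset Printing Implicit Defensive.

Import Order.TTheory.

Local Open Scope classical_set_scope.
Local Open Scope group_scope.
Local Open Scope order_scope.

(** * Transport of suprema and compactness along isomorphisms *)

Section Isomorphisms.

(** Reflecting the order forces injectivity by antisymmetry, so surjectivity gives a bijection. *)
Lemma isomorphic_mono_surj {d d'} {M : orderedMagmaType d}
    {M' : orderedMagmaType d'} (f : M -> M') :
  {mono f : x y / x <= y} -> (forall y, exists x, f x = y) ->
  {morph f : x y / x * y} -> isomorphic M M'.
Proof.
move=> fmono fsurj fmul; exists f; split=> //.
have finj : injective f by exact: inc_inj.
pose g y := sval (cid (fsurj y)).
have gK : cancel g f by move=> y; exact: svalP (cid (fsurj y)).
by exists g => // x; apply: finj; rewrite gK.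
Qed.

Lemma isomorphic_sym {d d'} {M : orderedMagmaType d}
    {M' : orderedMagmaType d'} : isomorphic M M' -> isomorphic M' M.
Proof.
move=> [f [[g fK gK] fmono fmul]]; exists g; split; first by exists f.
- by move=> x y; rewrite -fmono !gK.
- by move=> x y; rewrite -{1}(gK x) -{1}(gK y) -fmul fK.
Qed.

Lemma isomorphic_trans {d d' d''} {M : orderedMagmaType d}
    {M' : orderedMagmaType d'} {M'' : orderedMagmaType d''} :
  isomorphic M M' -> isomorphic M' M'' -> isomorphic M M''.
Proof.
move=> [f [fbij fmono fmul]] [g [gbij gmono gmul]]; exists (g \o f); split.
- exact: bij_comp.
- by move=> x y /=; rewrite gmono fmono.
- by move=> x y /=; rewrite fmul gmul.
Qed.

Section OrderIso.
Context {d d'} {S : porderType d} {S' : porderType d'}.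
Variables (f : S -> S') (g : S' -> S).
Hypotheses (fK : cancel f g) (gK : cancel g f).
Hypothesis fmono : {mono f : x y / x <= y}.

Lemma isLub_iso (X : set S) s : isLub X s -> isLub (f @` X) (f s).
Proof.
move=> [ubs lubs]; split=> [_ [x Xx <-]|b ub_b].
  by rewrite fmono; exact: ubs.
rewrite -(gK b) fmono; apply: lubs => x Xx.
by rewrite -fmono gK; apply: ub_b; exists x.
Qed.

(** Valid for any order embedding, it is applied later to [val] on subtypes as well as to
    isomorphisms. *)
Lemma directed_image (D : set S) : directed D -> directed (f @` D).
Proof.
move=> /directedP[[x Dx] Ddir]; apply/directedP; split; first by exists (f x), x.
move=> _ _ [y Dy <-] [z Dz <-]; have [u [Du yu zu]] := Ddir _ _ Dy Dz.
by exists (f u); split; rewrite ?fmono //; exists u.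
Qed.

End OrderIso.

Lemma compact_iso {d d'} {S : porderType d} {S' : porderType d'}
    (f : S -> S') (g : S' -> S) (x : S) :
  cancel f g -> cancel g f -> {mono f : x y / x <= y} ->
  compact_element x -> compact_element (f x).
Proof.
move=> fK gK fmono cx D s Ddir Ds xs.
have gmono : {mono g : x y / x <= y} by move=> y z; rewrite -fmono !gK.
have [|_ [y Dy <-] xy] :=
  cx _ _ (directed_image gmono Ddir) (isLub_iso fK gmono Ds).
  by rewrite -fmono gK.
by exists y; rewrite // -(gK y) fmono.
Qed.

Lemma near_prequantale_isomorphic {d d'} {M : orderedMagmaType d}
    {M' : orderedMagmaType d'} :
  isomorphic M M' -> near_prequantale M -> near_prequantale M'.
Proof.
move=> [f [[g fK gK] fmono fmul]] npq X [x Xx].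
have [|s Xs sM] := npq (g @` X); first by exists (g x), x.
(* Suprema in [M'] are computed by pulling [X] back along [g]; this identity returns to [X]. *)
have fgX : f @` (g @` X) = X.
  by rewrite image_comp; apply: eq_image_id => y _; exact: gK.
exists (f s); first by rewrite -fgX; exact (isLub_iso gK fmono Xs).
move=> a; have [/(isLub_iso gK fmono) sl /(isLub_iso gK fmono) sr] :=
  sM (g a).
rewrite fmul gK image_comp image_comp in sl.
rewrite fmul gK image_comp image_comp in sr.
split; [move: sl|move: sr]; congr isLub.
- by apply: eq_imagel => y _; rewrite /= fmul !gK.
- by apply: eq_imagel => y _; rewrite /= fmul !gK.
Qed.

Lemma precoherent_isomorphic {d d'} {M : orderedMagmaType d}
    {M' : orderedMagmaType d'} :
  isomorphic M M' -> precoherent M -> precoherent M'.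
Proof.
move=> [f [[g fK gK] fmono fmul]] [Mc Mm].
have gmono : {mono g : x y / x <= y} by move=> y z; rewrite -fmono !gK.
split=> [y|x y cx cy].
- have [X Xc Xy] := Mc (g y); exists (f @` X).
    by move=> _ [x Xx <-]; exact (compact_iso fK gK fmono (Xc _ Xx)).
  by rewrite -(gK y); exact (isLub_iso gK fmono Xy).
- rewrite -(gK x) -(gK y) -fmul; apply: (compact_iso fK gK fmono).
  exact (Mm _ _ (compact_iso gK fK gmono cx) (compact_iso gK fK gmono cy)).
Qed.

End Isomorphisms.

(** * Compact elements of a poset *)

Section CompactElements.
Context {d} {S : porderType d}.
Implicit Types x y s : S.

(** The directed set has members above [x] and above [y]; a common upper bound of these inside it is
    above [s]. *)
Lemma compact_lub2 x y s :
  compact_element x -> compact_element y -> isLub [set x; y] s ->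
  compact_element s.
Proof.
move=> cx cy [ubs lubs] D t Ddir Dt st.
have [|u Du xu] := cx D t Ddir Dt.
  by apply: le_trans st; apply: ubs; left.
have [|v Dv yv] := cy D t Ddir Dt.
  by apply: le_trans st; apply: ubs; right.
have [_ /(_ _ _ Du Dv)[w [Dw uw vw]]] := (directedP D).1 Ddir.
exists w => //; apply: lubs => _ [] ->; first exact: le_trans xu uw.
exact: le_trans yv vw.
Qed.

Lemma compact_bottom x : (forall y, x <= y) -> compact_element x.
Proof. by move=> xmin D s [[y Dy] _] _ _; exists y. Qed.

End CompactElements.

(** * Representation by ideals of compact elements *)

Section PrecoherentNearPrequantale.
Context {d} {M : orderedMagmaType d}.
Hypotheses (Mpc : precoherent M) (Mnpq : near_prequantale M).
Implicit Types x y k : M.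

Definition compacts_below x : set M := [set k | compact_element k /\ k <= x].

Lemma compacts_below_lub x : isLub (compacts_below x) x.
Proof.
have [X Xc [ubX lubX]] := Mpc.1 x; split=> [k []//|b ub_b].
by apply: lubX => k Xk; apply: ub_b; split; [exact: Xc|exact: ubX].
Qed.

Lemma lub2_exists x y : exists s, isLub [set x; y] s.
Proof. by have [|s] := @Mnpq [set x; y]; [exists x; left|exists s]. Qed.

Lemma compacts_below_directed x : directed (compacts_below x).
Proof.
apply/directedP; split.
  have [X Xc [ubX lubX]] := Mpc.1 x.
  have [[k Xk]|/nonemptyPn X0] := pselect (X !=set0).
    by exists k; split; [exact: Xc|exact: ubX].
  (* Near prequantales need not have a least element, but here [x] is the supremum of the empty set,
     hence least and therefore compact. *)
  by exists x; split=> //; apply: compact_bottom => y; apply: lubX; rewrite X0.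
move=> k l [ck kx] [cl lx]; have [s kls] := lub2_exists k l.
exists s; split; last 2 first.
- by apply: kls.1; left.
- by apply: kls.1; right.
- split; first exact: compact_lub2 ck cl kls.
  by apply: kls.2 => _ [] ->.
Qed.

Lemma compacts_sub_mult_semilattice : sub_mult_semilattice (@compacts d M).
Proof.
split=> [x y cx cy|x y cx cy|a x y s _ _ _ xys|a x y s _ _ _ xys].
- exact: Mpc.2.
- have [s xys] := lub2_exists x y; exists s => //.
  exact: compact_lub2 cx cy xys.
- have [|t xyt tM] := @Mnpq [set x; y]; first by exists x; left.
  rewrite (isLub_uniq xys xyt); have [+ _] := tM a.
  by rewrite image_setU !image_set1.
- have [|t xyt tM] := @Mnpq [set x; y]; first by exists x; left.
  rewrite (isLub_uniq xys xyt); have [_ +] := tM a.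
  by rewrite image_setU !image_set1.
Qed.

(** Products preserve nonempty suprema in each variable, so the supremum is split first in the left
    factor and then in the right one. *)
Lemma compacts_below_mul_lub x y :
  isLub (mul_set (compacts_below x) (compacts_below y)) (x * y).
Proof.
have xne := (compacts_below_directed x).1.
have yne := (compacts_below_directed y).1.
split=> [_ [k [_ kx] [l [_ ly] <-]]|b ub_b]; first exact: lemul.
have [s xs sM] := Mnpq xne; rewrite (isLub_uniq (compacts_below_lub x) xs).
apply: (sM y).2.2 => _ [k xk <-].
have [t yt tM] := Mnpq yne; rewrite (isLub_uniq (compacts_below_lub y) yt).
by apply: (tM k).1.2 => _ [l yl <-]; apply: ub_b; exists k => //; exists l.
Qed.

Lemma compacts_below_mul_directed x y :
  directed (mul_set (compacts_below x) (compacts_below y)).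
Proof.
have [[k xk] xdir] := (directedP _).1 (compacts_below_directed x).
have [[l yl] ydir] := (directedP _).1 (compacts_below_directed y).
apply/directedP; split; first by exists (k * l), k => //; exists l.
move=> _ _ [k1 xk1 [l1 yl1 <-]] [k2 xk2 [l2 yl2 <-]].
have [k3 [xk3 k13 k23]] := xdir _ _ xk1 xk2.
have [l3 [yl3 l13 l23]] := ydir _ _ yl1 yl2.
exists (k3 * l3); split; [|exact: lemul|exact: lemul].
by exists k3 => //; exists l3.
Qed.

Section Representation.
Variable h : sub_mult_semilattice (@compacts d M).

Definition below_set x : set (sub_msl h) := [set k | val k <= x].

Lemma below_set_ideal x : is_ideal (below_set x).
Proof.
have [[k [ck kx]] xdir] := (directedP _).1 (compacts_below_directed x).
split; last by move=> k1 k2 k1x k21; exact: le_trans k1x.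
apply/directedP; split; first by exists (sub_Sub h ck).
move=> k1 k2 k1x k2x.
have [||k3 [[ck3 k3x] k13 k23]] := xdir (val k1) (val k2).
- by split=> //; exact: (sub_mslP k1).
- by split=> //; exact: (sub_mslP k2).
by exists (sub_Sub h ck3); split; rewrite // -Order.le_val.
Qed.

Definition below x : idl (sub_msl h) :=
  Sub (below_set x) (mem_set (below_set_ideal x)).

(** The order is reflected because [x] is the supremum of the compact elements below it. *)
Lemma below_mono : {mono below : x y / x <= y}.
Proof.
move=> x y; rewrite -Order.le_val; apply/idP/idP; rewrite subsetEset /= => xy.
  apply: (compacts_below_lub x).2 => k [ck kx].
  exact: (xy (sub_Sub h ck)).
by move=> k kx; exact: le_trans kx xy.
Qed.

Lemma below_surj (I : idl (sub_msl h)) : exists x, below x = I.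
Proof.
have [Idir Idown] := idlP I.
have [[k Ik] Idir2] := (directedP _).1 Idir.
(* The preimage of [I] is its supremum in [M]: a compact element below it is below a member of [I],
   hence in [I]. *)
have [|s Is _] := @Mnpq (val @` val I); first by exists (val k), k.
exists s; apply: val_inj; rewrite /= predeqE => l; split=> [ls|Il]; last first.
  by apply: Is.1; exists l.
have vIdir : directed (val @` val I) by exact: directed_image.
have [_ [m Im <-] lm] := sub_mslP l _ _ vIdir Is ls.
exact: Idown Im lm.
Qed.

Lemma below_mul : {morph below : x y / x * y}.
Proof.
move=> x y; apply: val_inj; apply/seteqP; split=> k.
- move=> kxy.
  (* Since [x * y] is a directed supremum of products of compact elements, the compact [k] lies
     below a single such product, and a one-element [T] suffices. *)
  have [_ [l [cl lx] [m [cm my] <-]] klm] := sub_mslP k _ _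
    (compacts_below_mul_directed x y) (compacts_below_mul_lub x y) kxy.
  exists [set sub_Sub h cl * sub_Sub h cm], (sub_Sub h cl * sub_Sub h cm).
  split=> //.
  + by exists (sub_Sub h cl * sub_Sub h cm).
  + by move=> _ ->; exists (sub_Sub h cl) => //; exists (sub_Sub h cm).
  + by split=> [_ ->//|b]; apply.
- move=> [T [s [fT _ Txy [_ lubs] ks]]].
  have [Idir Idown] := below_set_ideal (x * y).
  (* The finite set [T] is bounded inside the ideal of [x * y], so its supremum stays in that
     ideal. *)
  have [|u uxy ub_u] := Idir.2 T fT.
    by move=> _ /Txy[l lx [m my <-]]; exact: lemul.
  by apply: Idown uxy _; apply: le_trans ks _; exact: lubs.
Qed.

Lemma isomorphic_idl_compacts : isomorphic M (idl (sub_msl h)).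
Proof.
exact: isomorphic_mono_surj below_mono below_surj below_mul.
Qed.

End Representation.

End PrecoherentNearPrequantale.

(** * Images of nuclei *)

Section NucleusImage.
Context {d} {P : orderedMagmaType d} {star : P -> P} (h : nucleus star).
Implicit Types (x y z : P) (a b : nucleus_image h).

Let starC := nucleus_closure h.

Lemma nucleus_image_fixed a : star (val a) = val a.
Proof.
have := valP a; rewrite inE => -[x _ <-]; exact: closure_idem starC x.
Qed.

Definition to_nucleus_image x : nucleus_image h :=
  Sub (star x) (mem_set (imageT star x)).

(** This is the adjunction between [star], corestricted to its image, and the inclusion [val]; most
    inequalities below are moved across it. *)
Lemma to_nucleus_image_le x a : (to_nucleus_image x <= a) = (x <= val a).
Proof.
rewrite -Order.le_val /=; apply/idP/idP => [|xa].
  exact: le_trans (closure_expansive starC x).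
by rewrite -nucleus_image_fixed; exact: closure_homo starC _ _ xa.
Qed.

(** Suprema in the image are closures of suprema in [P], as a left adjoint preserves them. *)
Lemma nucleus_image_lub (X : set (nucleus_image h)) t :
  isLub (val @` X) t -> isLub X (to_nucleus_image t).
Proof.
move=> [ubt lubt]; split=> [a Xa|b ub_b].
  rewrite -Order.le_val; apply: le_trans (closure_expansive starC t).
  by apply: ubt; exists a.
rewrite to_nucleus_image_le; apply: lubt => _ [a Xa <-].
by rewrite Order.le_val; exact: ub_b.
Qed.

Lemma nucleus_image_near_prequantale :
  near_prequantale P -> near_prequantale (nucleus_image h).
Proof.
move=> npq X [x Xx]; have [|t Xt tM] := npq (val @` X); first by exists (val x), x.
have Xs := nucleus_image_lub Xt.
exists (to_nucleus_image t) => // a; split; split=> [_ [y Xy <-]|b ub_b].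
- by apply: lemul => //; exact: Xs.1.
- rewrite [_ * _](_ : _ = to_nucleus_image (val a * star t)) //.
  rewrite to_nucleus_image_le -(nucleus_image_fixed a).
  (* The nucleus law moves the closure outside, and the adjunction then removes it: only [val a * t]
     has to be bounded, by distributivity in [P]. *)
  apply: le_trans (nucleus_mul h _ _) _.
  rewrite -[star _]/(val (to_nucleus_image _)) Order.le_val to_nucleus_image_le.
  apply: (tM (val a)).1.2 => _ [_ [y Xy <-] <-].
  by rewrite -to_nucleus_image_le; apply: ub_b; exists y.
- by apply: lemul => //; exact: Xs.1.
- rewrite [_ * _](_ : _ = to_nucleus_image (star t * val a)) //.
  rewrite to_nucleus_image_le -(nucleus_image_fixed a).
  apply: le_trans (nucleus_mul h _ _) _.
  rewrite -[star _]/(val (to_nucleus_image _)) Order.le_val to_nucleus_image_le.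
  apply: (tM (val a)).2.2 => _ [_ [y Xy <-] <-].
  by rewrite -to_nucleus_image_le; apply: ub_b; exists y.
Qed.

Hypotheses (Ppc : precoherent P) (Pnpq : near_prequantale P).
Hypothesis starF : finitary star.

Lemma to_nucleus_image_compact x :
  compact_element x -> compact_element (to_nucleus_image x).
Proof.
move=> cx D s Ddir Ds xs.
have vDdir : directed (val @` D) by exact: directed_image.
have [t Dt _] := Pnpq vDdir.1.
(* Finitarity makes the supremum [t], taken in [P], of a directed set of closed elements itself
   closed, so compactness of [x] in [P] applies to it. *)
have starD : star @` (val @` D) = val @` D.
  by apply: eq_image_id => _ [a _ <-]; exact: nucleus_image_fixed.
have := starF vDdir Dt; rewrite starD => /isLub_uniq/(_ Dt) start.
have [|_ [a Da <-] xa] := cx _ _ vDdir Dt; last first.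
- by exists a; rewrite // to_nucleus_image_le.
- rewrite -start -[star t]/(val (to_nucleus_image t)) -to_nucleus_image_le.
  by apply: le_trans xs _; apply: Ds.2; exact: (nucleus_image_lub Dt).1.
Qed.

(** The closures of the compact elements of [P] below [val a] form a directed set with supremum [a];
    by compactness one of them is already [a]. *)
Lemma nucleus_image_compactP a :
  compact_element a -> exists2 x, compact_element x & a = to_nucleus_image x.
Proof.
move=> ca; pose D := to_nucleus_image @` compacts_below (val a).
have [[x xa] adir] := (directedP _).1 (compacts_below_directed Ppc Pnpq (val a)).
have Ddir : directed D.
  apply/directedP; split; first by exists (to_nucleus_image x), x.
  move=> _ _ [y ya <-] [z za <-]; have [u [ua yu zu]] := adir _ _ ya za.
  exists (to_nucleus_image u); split; first by exists u.
  - by rewrite -Order.le_val; exact: closure_homo starC _ _ yu.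
  - by rewrite -Order.le_val; exact: closure_homo starC _ _ zu.
have Da : isLub D a.
  split=> [_ [y [_ ya] <-]|b ub_b]; first by rewrite to_nucleus_image_le.
  rewrite -Order.le_val; apply: (compacts_below_lub Ppc (val a)).2 => y ya.
  by rewrite -to_nucleus_image_le; apply: ub_b; exists y.
have [_ [y [cy ya] <-] ay] := ca D a Ddir Da (lexx a).
by exists y => //; apply/le_anti; rewrite ay to_nucleus_image_le.
Qed.

Lemma nucleus_image_precoherent : precoherent (nucleus_image h).
Proof.
split=> [a|a b /nucleus_image_compactP[x cx ->] /nucleus_image_compactP[y cy ->]].
- have [X Xc [ubX lubX]] := Ppc.1 (val a).
  exists (to_nucleus_image @` X).
    by move=> _ [x Xx <-]; apply: to_nucleus_image_compact; exact: Xc.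
  split=> [_ [x Xx <-]|b ub_b]; first by rewrite to_nucleus_image_le; exact: ubX.
  rewrite -Order.le_val; apply: lubX => x Xx.
  by rewrite -to_nucleus_image_le; apply: ub_b; exists x.
(* The product in the image of two closures is the closure of the product, so compactness of [x * y]
   in [P] is enough. *)
- rewrite [_ * _](_ : _ = to_nucleus_image (x * y)).
    by apply: to_nucleus_image_compact; exact: Ppc.2.
  apply/le_anti/andP; split.
  + rewrite [X in X <= _](_ : _ = to_nucleus_image (star x * star y)) //.
    by rewrite to_nucleus_image_le; exact: nucleus_mul.
  + rewrite to_nucleus_image_le; apply: le_trans (closure_expansive starC _).
    by apply: lemul; exact: closure_expansive.
Qed.

End NucleusImage.

(** * The ordered magma of nonempty subsets *)

Section NonemptySets.
Context {d} {N : orderedMagmaType d}.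
Implicit Types (X Y : nonempty_sets N) (D : set (nonempty_sets N)).

Lemma nonempty_sets_leE X Y : (X <= Y) = (val X `<=` val Y) :> Prop.
Proof. by rewrite -Order.le_val subsetEset. Qed.

Definition mk_nonempty (A : set N) (A0 : A !=set0) : nonempty_sets N :=
  Sub A (mem_set A0).

Lemma bigcup_nonempty D : D !=set0 -> \bigcup_(X in D) val X !=set0.
Proof. by move=> [X DX]; have [x Xx] := nonempty_setsP X; exists x, X. Qed.

Lemma nonempty_sets_lub D (D0 : D !=set0) :
  isLub D (mk_nonempty (bigcup_nonempty D0)).
Proof.
split=> [X DX|Y ubY]; rewrite nonempty_sets_leE.
  by move=> x Xx; exists X.
by move=> x [X /ubY]; rewrite nonempty_sets_leE => XY /XY.
Qed.

Lemma nonempty_sets_lubE D X :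
  D !=set0 -> isLub D X -> val X = \bigcup_(Y in D) val Y.
Proof. by move=> D0 /isLub_uniq/(_ (nonempty_sets_lub D0)) ->. Qed.

Lemma finite_sub_directed_bigcup D (F : set N) :
  directed D -> finite_set F -> F `<=` \bigcup_(X in D) val X ->
  exists2 X, D X & F `<=` val X.
Proof.
move=> Ddir fF FD; have [X0 _] := Ddir.1.
have /choice[f fP] : forall x, exists X, F x -> D X /\ val X x.
  (* A member of [D] containing [x] is chosen for each [x] in [F]; [X0] is a default value outside
     [F]. *)
  move=> x; have [Fx|nFx] := pselect (F x); last by exists X0.
  by have [X DX Xx] := FD x Fx; exists X.
have [||X DX ubX] := Ddir.2 (f @` F).
- exact: finite_image.
- by move=> _ [x /fP[Df _] <-].
exists X => // x Fx; have [_] := fP x Fx.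
have : f x <= X by apply: ubX; exists x.
by rewrite nonempty_sets_leE; apply.
Qed.

Lemma nonempty_sets_compactP X : compact_element X <-> finite_set (val X).
Proof.
split=> [cX|fX D S Ddir DS]; last first.
  rewrite nonempty_sets_leE (nonempty_sets_lubE Ddir.1 DS) => XS.
  have [Y DY XY] := finite_sub_directed_bigcup Ddir fX XS.
  by exists Y; rewrite // nonempty_sets_leE.
(* The finite nonempty subsets of [X] are directed with union [X], so compactness encloses [X] in
   one of them. *)
pose D := [set Y | finite_set (val Y) /\ Y <= X].
have sing0 (x : N) : [set x] !=set0 by exists x.
have Dsing x : val X x -> D (mk_nonempty (sing0 x)).
  by move=> Xx; split; [exact: finite_set1|rewrite nonempty_sets_leE => _ ->].
have Ddir : directed D.
  apply/directedP; split.
    by have [x Xx] := nonempty_setsP X; eexists; exact: Dsing Xx.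
  move=> Y Z [fY YX] [fZ ZX]; have [y Yy] := nonempty_setsP Y.
  have YZ0 : val Y `|` val Z !=set0 by exists y; left.
  exists (mk_nonempty YZ0); split; last 2 first.
  - by rewrite nonempty_sets_leE => x; left.
  - by rewrite nonempty_sets_leE => x; right.
  - rewrite !nonempty_sets_leE in YX ZX *; split; first by rewrite finite_setU.
    by rewrite nonempty_sets_leE => x [/YX|/ZX].
have DX : isLub D X.
  split=> [Y []//|Y ubY]; rewrite nonempty_sets_leE => x /Dsing/ubY.
  by rewrite nonempty_sets_leE; apply.
have [Y [fY _]] := cX D X Ddir DX (lexx X).
by rewrite nonempty_sets_leE => XY; exact: sub_finite_set XY fY.
Qed.

Lemma nonempty_sets_near_prequantale : near_prequantale (nonempty_sets N).
Proof.
move=> D D0; exists (mk_nonempty (bigcup_nonempty D0)).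
  exact: nonempty_sets_lub.
have [ubD _] := nonempty_sets_lub D0.
move=> A; split; split=> [_ [X DX <-]|B ubB].
- by apply: lemul => //; exact: ubD.
- rewrite nonempty_sets_leE => _ [a Aa [x [X DX Xx] <-]].
  have : A * X <= B by apply: ubB; exists X.
  by rewrite nonempty_sets_leE; apply; exists a => //; exists x.
- by apply: lemul => //; exact: ubD.
- rewrite nonempty_sets_leE => _ [x [X DX Xx] [a Aa <-]].
  have : X * A <= B by apply: ubB; exists X.
  by rewrite nonempty_sets_leE; apply; exists x => //; exists a.
Qed.

Lemma nonempty_sets_precoherent : precoherent (nonempty_sets N).
Proof.
split=> [X|X Y /nonempty_sets_compactP fX /nonempty_sets_compactP fY].
- exists [set Y | compact_element Y /\ Y <= X]; first by move=> Y [].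
  split=> [Y []//|Y ubY]; rewrite nonempty_sets_leE => x Xx.
  have x0 : [set x] !=set0 by exists x.
  (* Singletons are compact, and every set is the union of its singletons. *)
  have : mk_nonempty x0 <= Y.
    apply: ubY; split; first exact/nonempty_sets_compactP/finite_set1.
    by rewrite nonempty_sets_leE => _ ->.
  by rewrite nonempty_sets_leE; apply.
- by apply/nonempty_sets_compactP; exact: finite_image2.
Qed.

End NonemptySets.

(** * Ideals as fixed points of a finitary nucleus *)

Section DownNucleus.

Lemma ideal_joinP {d} {S : joinSemilatticeType d} (I : set S) :
  I !=set0 -> (forall x y, I x -> y <= x -> I y) ->
  (forall x y, I x -> I y -> I (Order.join x y)) -> is_ideal I.
Proof.
move=> I0 Idown IU; split=> //; apply/directedP; split=> // x y Ix Iy.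
by exists (Order.join x y); split; [exact: IU|exact: leUl|exact: leUr].
Qed.

Lemma ideal_join {d} {S : joinSemilatticeType d} (I : set S) x y :
  is_ideal I -> I x -> I y -> I (Order.join x y).
Proof.
move=> [/directedP[_ Idir] Idown] Ix Iy; have [u [Iu xu yu]] := Idir _ _ Ix Iy.
by apply: Idown Iu _; rewrite leUx xu yu.
Qed.

(** Together with [down_join_ideal], this makes [down_join X] the ideal generated by a nonempty
    [X]. *)
Lemma down_join_min {d} {S : joinSemilatticeType d} (X I : set S) :
  is_ideal I -> X `<=` I -> down_join X `<=` I.
Proof.
move=> [[_ Idir] Idown] XI y [T [s [fT _ TX [_ lubs] ys]]].
have [u Iu ubu] := Idir T fT (subset_trans TX XI).
by apply: Idown Iu _; apply: le_trans ys _; exact: lubs.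
Qed.

Lemma down_join_id {d} {S : joinSemilatticeType d} (I : set S) :
  is_ideal I -> down_join I = I.
Proof.
move=> Iid; apply/seteqP; split; last exact: sub_down_join.
exact: down_join_min.
Qed.

Context {d} {N : multSemilatticeType d}.
Implicit Types X Y : nonempty_sets N.

Lemma down_join_mul (A B : set N) : A !=set0 -> B !=set0 ->
  mul_set (down_join A) (down_join B) `<=` down_join (mul_set A B).
Proof.
move=> [a0 Aa0] [b0 Bb0].
have ABid : is_ideal (down_join (mul_set A B)).
  by apply: down_join_ideal; exists (a0 * b0), a0 => //; exists b0.
have AB a b : A a -> B b -> down_join (mul_set A B) (a * b).
  by move=> Aa Bb; apply: sub_down_join; exists a => //; exists b.
have AdB a b : A a -> down_join B b -> down_join (mul_set A B) (a * b).
  (* For fixed [a], the [y] with [a * y] in the target form an ideal, by distributivity and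
     monotonicity. It contains [B], hence the ideal generated by [B]. *)
  move=> Aa; apply: (@down_join_min _ _ B
    [set y | down_join (mul_set A B) (a * y)]); last by move=> y /= /AB; apply.
  apply: ideal_joinP => /= [|x y abx yx|x y abx aby].
  - by exists b0; exact: AB.
  - by apply: ABid.2 abx _; exact: lemul.
  - by rewrite mulUr; exact: ideal_join.
(* The same argument in the left factor, now with [b] fixed in [down_join B]. *)
move=> _ [a + [b Bb <-]]; apply: (@down_join_min _ _ A
  [set x | down_join (mul_set A B) (x * b)]); last by move=> x /= /AdB; apply.
apply: ideal_joinP => /= [|x y abx yx|x y abx aby].
- by exists a0; exact: AdB.
- by apply: ABid.2 abx _; exact: lemul.
- by rewrite mulUl; exact: ideal_join.
Qed.

Lemma down_join_nonempty X : down_join (val X) !=set0.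
Proof.
by have [x Xx] := nonempty_setsP X; exists x; exact: sub_down_join.
Qed.

Definition down_star X : nonempty_sets N := mk_nonempty (down_join_nonempty X).

Lemma down_star_nucleus : nucleus down_star.
Proof.
split; first split.
- by move=> X; rewrite nonempty_sets_leE; exact: sub_down_join.
- by move=> X Y; rewrite !nonempty_sets_leE; exact: down_join_mono.
- move=> X; apply: val_inj; apply: down_join_id; apply: down_join_ideal.
  exact: nonempty_setsP.
- move=> X Y; rewrite nonempty_sets_leE.
  by apply: down_join_mul; exact: nonempty_setsP.
Qed.

(** Membership in [down_join] is witnessed by a finite [T], which lies in a single member of a
    directed union. *)
Lemma down_star_finitary : finitary down_star.
Proof.
move=> D X Ddir DX; split=> [_ [Y DY <-]|Y ubY].
  by apply: (closure_homo (nucleus_closure down_star_nucleus)); exact: DX.1.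
rewrite nonempty_sets_leE => x [T [s [fT T0 TX Ts xs]]].
rewrite (nonempty_sets_lubE Ddir.1 DX) in TX.
have [Z DZ TZ] := finite_sub_directed_bigcup Ddir fT TX.
have : down_star Z <= Y by apply: ubY; exists Z.
by rewrite nonempty_sets_leE; apply; exists T, s.
Qed.

Lemma isomorphic_idl_nucleus_image :
  isomorphic (idl N) (nucleus_image down_star_nucleus).
Proof.
pose f (I : idl N) :=
  to_nucleus_image down_star_nucleus
    (mk_nonempty (idlP I).1.1).
(* Ideals are already closed, so [f] leaves the underlying set unchanged; the two [val] strip the
   nucleus image and the nonempty subset. *)
have fE I : val (val (f I)) = val I by apply: down_join_id; exact: idlP.
apply: (@isomorphic_mono_surj _ _ _ _ f) => [I J|a|I J].
- apply/idP/idP; rewrite -!Order.le_val nonempty_sets_leE !fE.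
  + by rewrite subsetEset.
  + by rewrite subsetEset.
- have aid : is_ideal (val (val a)).
    rewrite -nucleus_image_fixed; apply: down_join_ideal; exact: nonempty_setsP.
  exists (Sub (val (val a)) (mem_set aid)).
  by apply: val_inj; apply: val_inj; rewrite fE.
- apply: val_inj; apply: val_inj; rewrite fE /=.
  by rewrite -[down_join (val I)]/(val (val (f I)))
    -[down_join (val J)]/(val (val (f J))) !fE.
Qed.

End DownNucleus.

(** * The cycle of implications *)

Unset Implicit Arguments.

Theorem corollary7p5 (d : Order.disp_t) (M : orderedMagmaType d) :
  [<-> precoherent M /\ near_prequantale M;
       exists (d' : Order.disp_t) (N : multSemilatticeType d'),
         isomorphic M (idl N);
       exists h : sub_mult_semilattice (@compacts d M),
         isomorphic M (idl (sub_msl h));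
       exists (d' : Order.disp_t) (N : multSemilatticeType d')
              (star : nonempty_sets N -> nonempty_sets N)
              (h : nucleus star),
         finitary star /\ isomorphic M (nucleus_image h)].
Proof.
have compl : precoherent M /\ near_prequantale M ->
    exists h : sub_mult_semilattice (@compacts d M),
      isomorphic M (idl (sub_msl h)).
  move=> [Mpc Mnpq]; exists (compacts_sub_mult_semilattice Mpc Mnpq).
  exact: isomorphic_idl_compacts.
have nucl d' (N : multSemilatticeType d') : isomorphic M (idl N) ->
    exists (star : nonempty_sets N -> nonempty_sets N) (h : nucleus star),
      finitary star /\ isomorphic M (nucleus_image h).
  move=> MN; exists down_star, down_star_nucleus.
  split; first exact: down_star_finitary.
  exact: isomorphic_trans MN isomorphic_idl_nucleus_image.
have coh d' (N : multSemilatticeType d')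
    (star : nonempty_sets N -> nonempty_sets N) (h : nucleus star) :
    finitary star -> isomorphic M (nucleus_image h) ->
    precoherent M /\ near_prequantale M.
  move=> starF /isomorphic_sym iso; split.
  - apply: (precoherent_isomorphic iso).
    apply: nucleus_image_precoherent starF; first exact: nonempty_sets_precoherent.
    exact: nonempty_sets_near_prequantale.
  - apply: (near_prequantale_isomorphic iso); apply: nucleus_image_near_prequantale.
    exact: nonempty_sets_near_prequantale.
tfae.
- by move=> /compl[h iso]; exists d, (sub_msl h).
(* An arbitrary [N] is not compared with the compact elements directly: the nucleus image first
   shows [M] to be a precoherent near prequantale, and [compl] then applies. *)
- by move=> [d' [N /nucl[star [h [starF iso]]]]]; exact: compl (coh _ _ _ _ starF iso).
- by move=> [h /nucl[star [h' ?]]]; exists d, (sub_msl h), star, h'.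
- by move=> [d' [N [star [h [starF iso]]]]]; exact: coh starF iso.
Qed.
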